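(* Let $(M,\gamma)$ be a causal manifold. (i) The family of $\gamma$-sets of $M$ is closed under arbitrary unions and intersections. (ii) The family of $\gamma$-sets is closed under taking closure and interior. (iii) If $A$ is a $\gamma$-set, then $\overline{\mathrm{Int}(A)}=\overline{A}$ and $\mathrm{Int}(\overline{A})=\mathrm{Int}(A)$. (iv) If $A$ is a $\gamma$-set and $\mathrm{Int}(A)\subset B\subset\overline{A}$, then $B$ is a $\gamma$-set.
   Context: Manifolds are real $C^\infty$-manifolds. A causal manifold $(M,\gamma)$ is a nonempty connected manifold $M$ with a subset $\gamma\subset TM$ which is open in $TM$, is a cone (invariant under multiplication by $\mathbb{R}_{>0}$ in the fibres), has convex fibres, and satisfies $\gamma_x\neq\varnothing$ for all $x\in M$. For $A,B\subset M$, the Whitney cone $C(A,B)\subset TM$ is described in a chart at $x_0\in M$ by: $v\in C_{x_0}(A,B)$ iff there are sequences $(x_n,y_n,c_n)\in A\times B\times\mathbb{R}_{>0}$ with $x_n\to x_0$, $y_n\to x_0$ and $c_n(x_n-y_n)\to v$. The strict normal cone is $N(A)=TM\setminus C(M\setminus A,A)$; equivalently, in a chart at $x$, $(x,v)\in N(A)$ iff there are an open cone $\gamma_0\ni v$ and an open neighborhood $U$ of $x$ such that $U\cap(U\cap A+\gamma_0)\subset A$. A subset $A\subset M$ is a $\gamma$-set if $\gamma\subset N(A)$. *)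

(* Defs.v *)
From HB Require Import structures.
From mathcomp Require Import all_boot all_order all_algebra.
From mathcomp Require Import all_classical all_reals all_analysis.

Set Implicit Arguments.
Unset Strict Implicit.
Unset Printing Implicit Defensive.

Import Order.TTheory GRing.Theory Num.Theory.
Import numFieldNormedType.Exports.

Local Open Scope classical_set_scope.
Local Open Scope ring_scope.

(* C^k maps on an open set [U]; in finite dimension, [f] is C^(k+1) iff it is
   differentiable and all the maps x |-> df_x(v), v fixed, are C^k. *)
Fixpoint Ck_on (R : realType) (m n : nat) (k : nat) (U : set 'rV[R]_m)
    (f : 'rV[R]_m -> 'rV[R]_n) : Prop :=
  if k is k'.+1 then
    (forall x, U x -> differentiable f x) /\
    (forall v, Ck_on k' U (fun x => 'd f x v))
  else forall x, U x -> {for x, continuous f}.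

Definition smooth_on (R : realType) (m n : nat) (U : set 'rV[R]_m)
    (f : 'rV[R]_m -> 'rV[R]_n) : Prop := forall k, Ck_on k U f.

(* A homeomorphism from the open set [chart_dom] onto an open subset of R^n;
   the values of [chart_fun] and [chart_inv] elsewhere are irrelevant. *)
Record chart (R : realType) (n : nat) (M : topologicalType) := Chart {
  chart_dom : set M ;
  chart_fun :> M -> 'rV[R]_n ;
  chart_inv : 'rV[R]_n -> M ;
  chart_dom_open : open chart_dom ;
  chart_im_open : open (chart_fun @` chart_dom) ;
  chart_funK : forall x, chart_dom x -> chart_inv (chart_fun x) = x ;
  chart_fun_cont : forall x, chart_dom x -> {for x, continuous chart_fun} ;
  chart_inv_cont : forall p, (chart_fun @` chart_dom) p ->
    {for p, continuous chart_inv} }.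

Definition transition (R : realType) (n : nat) (M : topologicalType)
    (phi psi : chart R n M) : 'rV[R]_n -> 'rV[R]_n := psi \o chart_inv phi.

(* The atlas is not required to be maximal: any smooth atlas determines the
   smooth structure. *)
Record manifold (R : realType) (n : nat) := Manifold {
  manifold_sort :> topologicalType ;
  manifold_hausdorff : hausdorff_space manifold_sort ;
  manifold_second_countable : @second_countable manifold_sort ;
  atlas : set (chart R n manifold_sort) ;
  atlas_cover : forall x : manifold_sort,
    exists2 phi, atlas phi & chart_dom phi x ;
  atlas_smooth : forall phi psi, atlas phi -> atlas psi ->
    smooth_on (phi @` (chart_dom phi `&` chart_dom psi)) (transition phi psi) }.

Definition chart_at (R : realType) (n : nat) (M : manifold R n) (x : M) :=
  {phi : chart R n M | atlas phi /\ chart_dom phi x}.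

Lemma near_eq_diff (R : realType) (V W : normedModType R) (f g : V -> W)
    (x : V) :
  (\near x, f x = g x) -> differentiable f x ->
  'd g x = 'd f x :> (V -> W).
Proof.
move=> fg df; apply: diff_unique; first exact: diff_continuous.
have /eqaddoP fo := diff_locally df.
have fgx : f x = g x by exact: (nbhs_singleton fg).
have fg0 : \forall z \near (0 : V), f (z + x) = g (z + x).
  move: fg; rewrite (near_shift 0) => h.
  by apply: filterS h => z; rewrite /= subr0.
apply/eqaddoP => e e0.
apply: filterS2 (fo e e0) fg0 => z + fgz.
by rewrite /= !fctE /= fgz fgx.
Qed.

Lemma near_diff_comp (R : realType) (U V W : normedModType R) (f : U -> V)
    (g : V -> W) (h : U -> W) (x : U) (w : U) :
  (\near x, g (f x) = h x) -> differentiable f x -> differentiable g (f x) ->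
  'd h x w = 'd g (f x) ('d f x w).
Proof.
move=> gfh df dg.
have dgf : differentiable (g \o f) x by exact: differentiable_comp.
by rewrite (near_eq_diff gfh dgf) diff_comp.
Qed.

Section Tangent.
Context (R : realType) (n : nat) (M : manifold R n).

Lemma transition_differentiable (x : M) (phi psi : chart_at x) :
  differentiable (transition (sval phi) (sval psi)) (sval phi x).
Proof.
case: phi psi => [phi [aphi phix]] [psi [apsi psix]] /=.
by have [+ _] := atlas_smooth aphi apsi 1%N; apply; exists x.
Qed.

Lemma transition_diff_comp (x : M) (phi psi chi : chart_at x) (w : 'rV[R]_n) :
  'd (transition (sval phi) (sval chi)) (sval phi x) w =
  'd (transition (sval psi) (sval chi)) (sval psi x)
    ('d (transition (sval phi) (sval psi)) (sval phi x) w).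
Proof.
have dfp := transition_differentiable phi psi.
have dpc := transition_differentiable psi chi.
have pE : transition (sval phi) (sval psi) (sval phi x) = sval psi x.
  by rewrite /transition /= chart_funK//; case: (svalP phi).
rewrite -pE; apply: near_diff_comp => //; last by rewrite pE.
have [_ phix] := svalP phi; have [_ psix] := svalP psi.
have invc : {for sval phi x, continuous (chart_inv (sval phi))}.
  by apply: chart_inv_cont; exists x.
have : \forall p \near sval phi x,
    chart_dom (sval psi) (chart_inv (sval phi) p).
  apply: invc; rewrite chart_funK//; apply: open_nbhs_nbhs; split=> //.
  exact: chart_dom_open.
by apply: filterS => p dp; rewrite /transition /= (chart_funK dp).
Qed.

(* A tangent vector at [x] is given by its coordinates in all the charts at
   [x], related by the differentials of the transition maps. *)
Definition is_tangent (x : M) : pred (chart_at x -> 'rV[R]_n) := fun v =>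
  `[< forall phi psi : chart_at x,
    v psi = 'd (transition (sval phi) (sval psi)) (sval phi x) (v phi) >].

Lemma is_tangent_submod (x : M) : GRing.submod_closed (@is_tangent x).
Proof.
split.
  by apply/asboolP => phi psi; rewrite linear0.
move=> a u v /asboolP Tu /asboolP Tv; apply/asboolP => phi psi.
by rewrite !fctE linearP -Tu -Tv.
Qed.
HB.instance Definition _ (x : M) :=
  GRing.isSubmodClosed.Build R (chart_at x -> 'rV[R]_n) (@is_tangent x)
    (is_tangent_submod x).

Record tangent (x : M) := Tangent {
  tangent_coord :> chart_at x -> 'rV[R]_n ;
  tangentP : tangent_coord \in @is_tangent x }.

HB.instance Definition _ (x : M) := [isSub for @tangent_coord x].
HB.instance Definition _ (x : M) := [Choice of tangent x by <:].
HB.instance Definition _ (x : M) := [SubChoice_isSubLmodule of tangent x by <:].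

Record tangent_bundle := TangentVector {
  base : M ;
  direction : tangent base }.

HB.instance Definition _ := gen_eqMixin tangent_bundle.
HB.instance Definition _ := gen_choiceMixin tangent_bundle.

(* The image of [W] under the chart (x, v) |-> (phi x, dphi_x v) of TM. *)
Definition bundle_chart_image (phi : chart R n M) (W : set tangent_bundle) :
    set ('rV[R]_n * 'rV[R]_n) :=
  [set p | exists t : tangent_bundle, exists psi : chart_at (base t),
    [/\ W t, sval psi = phi & p = (phi (base t), direction t psi)]].

Definition bundle_open (W : set tangent_bundle) : Prop :=
  forall phi, atlas phi -> open (bundle_chart_image phi W).

Lemma tangent_of_coord (x : M) (phi : chart_at x) (w : 'rV[R]_n) :
  exists v : tangent x, v phi = w.
Proof.
pose u (psi : chart_at x) : 'rV[R]_n :=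
  'd (transition (sval phi) (sval psi)) (sval phi x) w.
have Tu : u \in @is_tangent x.
  by apply/asboolP => psi chi; exact: transition_diff_comp.
exists (Tangent Tu); rewrite /= /u.
have [_ phix] := svalP phi.
rewrite (@near_eq_diff _ _ _ id)//; first by rewrite diff_val.
have : open_nbhs (sval phi x) (sval phi @` chart_dom (sval phi)).
  by split; [exact: chart_im_open | exists x].
move=> /open_nbhs_nbhs; apply: filterS => p [y dy <-].
by rewrite /transition /= chart_funK.
Qed.

Lemma bundle_chart_image_inj (phi : chart R n M) (s t : tangent_bundle)
    (psi : chart_at (base s)) (chi : chart_at (base t)) :
  sval psi = phi -> sval chi = phi -> phi (base s) = phi (base t) ->
  direction s psi = direction t chi -> s = t.
Proof.
case: s psi => x v; case: t chi => y w /= [chi [ac dc]] [psi [ap dp]] /=.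
move=> psiE chiE; subst psi; subst chi => xy.
have exy : x = y by rewrite -(chart_funK dp) xy chart_funK.
subst y => vw; congr TangentVector.
apply: val_inj; apply/funext => rho /=.
have /asboolP Tv := tangentP v; have /asboolP Tw := tangentP w.
rewrite (Tv (exist _ phi (conj ap dp))) (Tw (exist _ phi (conj ac dc))) /=.
by rewrite vw.
Qed.

Lemma bundle_openT : bundle_open setT.
Proof.
move=> phi aphi.
rewrite (_ : bundle_chart_image _ _ =
  (fst @^-1` (phi @` chart_dom phi) : set ('rV[R]_n * 'rV[R]_n))).
  by apply: open_comp; [move=> ? _; exact: cvg_fst | exact: chart_im_open].
apply/seteqP; split=> [_ [t [psi [_ <- ->]]]/=|[p w] /= [x dx xp]].
  by exists (base t) => //; case: (svalP psi).
have [v vw] :=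
  tangent_of_coord (exist _ phi (conj aphi dx) : chart_at x) w.
exists (TangentVector v), (exist _ phi (conj aphi dx)); split=> //=.
by rewrite xp vw.
Qed.

Lemma bundle_openI : setI_closed bundle_open.
Proof.
move=> U W oU oW phi aphi.
rewrite (_ : bundle_chart_image _ _ =
  bundle_chart_image phi U `&` bundle_chart_image phi W).
  by apply: openI; [exact: oU | exact: oW].
apply/seteqP; split=> [_ [t [psi [[Ut Wt] e ->]]]|p].
  by split; exists t, psi.
move=> [[s [psi [Us es ->]]] [t [chi [Wt et [e1 e2]]]]].
exists s, psi; split=> //; split=> //.
by rewrite (bundle_chart_image_inj es et e1 e2).
Qed.

Lemma bundle_open_bigU (I : Type) (F : I -> set tangent_bundle) :
  (forall i, bundle_open (F i)) -> bundle_open (\bigcup_i F i).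
Proof.
move=> oF phi aphi.
rewrite (_ : bundle_chart_image _ _ = \bigcup_i bundle_chart_image phi (F i)).
  by apply: bigcup_open => i _; exact: oF.
apply/seteqP; split=> [_ [t [psi [[i _ Ft] e ->]]]|p [i _ [t [psi [Ft e ->]]]]].
  by exists i => //; exists t, psi.
by exists t, psi; split=> //; exists i.
Qed.

HB.instance Definition _ := isOpenTopological.Build tangent_bundle
  bundle_openT bundle_openI bundle_open_bigU.

Definition fibre (gamma : set tangent_bundle) (x : M) : set (tangent x) :=
  [set v | gamma (TangentVector v)].

Record causal (gamma : set tangent_bundle) : Prop := Causal {
  causal_nonempty : [set: M] !=set0 ;
  causal_connected : connected [set: M] ;
  causal_open : open gamma ;
  causal_cone : forall (x : M) (v : tangent x) (c : R),
    0 < c -> fibre gamma v -> fibre gamma (c *: v) ;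
  causal_convex : forall x : M, convex_set (@fibre gamma x) ;
  causal_fibre_nonempty : forall x : M, @fibre gamma x !=set0 }.

Definition whitney_in_chart (A B : set M) (x0 : M) (phi : chart_at x0)
    (w : 'rV[R]_n) : Prop :=
  exists (x y : nat -> M) (c : nat -> R),
    [/\ forall k, (A `&` chart_dom (sval phi)) (x k),
        forall k, (B `&` chart_dom (sval phi)) (y k),
        forall k, 0 < c k,
        x @ \oo --> x0 /\ y @ \oo --> x0 &
        (fun k => c k *: (sval phi (x k) - sval phi (y k))) @ \oo --> w].

(* The condition on sequences does not depend on the chart at the base point. *)
Definition whitney_cone (A B : set M) : set tangent_bundle :=
  [set t | exists phi : chart_at (base t),
    whitney_in_chart A B phi (direction t phi)].

Definition strict_normal_cone (A : set M) : set tangent_bundle :=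
  ~` whitney_cone (~` A) A.

Definition gamma_set (gamma : set tangent_bundle) (A : set M) : Prop :=
  gamma `<=` strict_normal_cone A.

End Tangent.

(* Main.v *)
(* In a chart at x, with v in gamma_x, the condition v \notin C(M \ A, A) says
   that for some e > 0, b \in A implies b + t w \in A as long as both points are
   e-close to x, w is e-close to v and t > 0.  Since gamma is open, the radius e
   can be chosen independently of the gamma-set A: membership in A propagates
   along segments.  This gives unions and intersections.  Perturbing b and
   b + t w, the same condition shows that b in the closure of A implies b + t w
   in the interior of A; the other claims follow by choosing b or b + t w equal
   to x and letting t tend to 0. *)
Require Import Defs.
From HB Require Import structures.
From mathcomp Require Import all_boot all_order all_algebra.
From mathcomp Require Import all_classical all_reals all_analysis.
From mathcomp Require Import lra.

Set Implicit Arguments.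
Unset Strict Implicit.
Unset Printing Implicit Defensive.

Import Order.TTheory GRing.Theory Num.Theory.
Import numFieldNormedType.Exports.

Local Open Scope ring_scope.
Local Open Scope classical_set_scope.

(** Supremum argument: from a point of [T] within [d] of [sup T], one local step goes beyond
    [sup T], or reaches it when it equals 1. *)
Lemma segment_propagation (R : realType) (P : R -> Prop) :
  (forall t, 0 <= t <= 1 -> exists2 d, 0 < d &
    forall s s', 0 <= s -> s < s' -> s' <= 1 -> `|s - t| < d -> `|s' - t| < d ->
      P s -> P s') ->
  P 0 -> P 1.
Proof.
move=> loc P0.
pose T := [set t : R | 0 <= t <= 1 /\ P t].
have T0 : T 0 by split=> //; rewrite lexx ler01.
have supT : has_sup T.
  by split; [exists 0 | exists 1 => t [/andP[]]].
have s0 : 0 <= sup T by exact: sup_upper_bound.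
have s1 : sup T <= 1 by apply: ge_sup; [exists 0 | move=> t [/andP[]]].
have /loc[d d0 step] : 0 <= sup T <= 1 by rewrite s0 s1.
have [t [/andP[t0 t1] Pt] dt] := sup_adherent d0 supT.
have ts : t <= sup T by apply: sup_upper_bound => //; split=> //; rewrite t0 t1.
have td : `|t - sup T| < d by rewrite ltr_norml; apply/andP; split; lra.
move: s1; rewrite le_eqVlt => /orP[/eqP s1|s1].
  move: t1; rewrite le_eqVlt => /orP[/eqP <-//|t1].
  by apply: (step t) => //; rewrite s1 subrr normr0.
(* A point past the supremum but still within reach of the local step; it would belong to [T], a
   contradiction. *)
have [s' [ss' s'1 s'd]] : exists s', [/\ sup T < s', s' <= 1 & s' < sup T + d].
  exists (Num.min 1 (sup T + d / 2)); rewrite lt_min ge_min gt_min s1 lexx /=.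
  by split=> //; [|apply/orP; right]; lra.
have : s' <= sup T.
  apply: sup_upper_bound => //; split; first by apply/andP; split; lra.
  apply: (step t) => //; first lra.
  by rewrite ltr_norml; apply/andP; split; lra.
lra.
Qed.

(** * Strict normal cones read in a chart *)

Section LocalForm.
Context (R : realType) (n : nat) (M : manifold R n).
Implicit Types (A B : set M) (x a b : M).

(* With [A = B] this says, in the chart [phi], that
   U `&` (U `&` A + gamma0) is included in A, for U the ball of radius e at p
   and gamma0 the cone generated by the ball of radius e at v. *)
Definition flows_into (phi : chart R n M) (p v : 'rV[R]_n) (e : R) A B :=
  forall b a (c : R), chart_dom phi b -> chart_dom phi a ->
    `|phi b - p| < e -> `|phi a - p| < e ->
    0 < c -> `|c *: (phi a - phi b) - v| < e -> A b -> B a.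

Lemma chart_fun_cvg x (phi : chart_at x) :
  sval phi y @[y --> x] --> sval phi x.
Proof. by apply: chart_fun_cont; case: (svalP phi). Qed.
Arguments chart_fun_cvg {x} phi.

Lemma chart_inv_cvg x (phi : chart_at x) :
  chart_inv (sval phi) p @[p --> sval phi x] --> x.
Proof.
have [_ dx] := svalP phi.
rewrite -[X in _ --> X](chart_funK dx).
by apply: chart_inv_cont; exists x.
Qed.
Arguments chart_inv_cvg {x} phi.

(** If every radius fails, the counterexamples for the radii [harmonic k] form sequences that put
    [v] in the Whitney cone. Conversely, such sequences eventually satisfy all the [e]-bounds. *)
Lemma not_whitneyP x (phi : chart_at x) (v : 'rV[R]_n) A :
  ~ whitney_in_chart (~` A) A phi v <->
  exists2 e, 0 < e & flows_into (sval phi) (sval phi x) v e A A.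
Proof.
split=> [nW|[e e0 fl] [y [z [c [yP zP c0 [yx zx] cv]]]]]; last first.
  have nx : \forall y \near x, `|sval phi y - sval phi x| < e.
    exact: cvgr_distC_lt (chart_fun_cvg phi) _ e0.
  have ny : \forall k \near \oo, `|sval phi (y k) - sval phi x| < e.
    exact: (yx _ nx).
  have nz : \forall k \near \oo, `|sval phi (z k) - sval phi x| < e.
    exact: (zx _ nx).
  have nc : \forall k \near \oo, `|c k *: (sval phi (y k) - sval phi (z k)) - v| < e.
    exact: cvgr_distC_lt cv _ e0.
  have [k [[yk zk] ck]] := filter_ex (filterI (filterI ny nz) nc).
  have [nAy dy] := yP k; have [Az dz] := zP k.
  by apply: nAy; exact: (fl (z k) (y k) (c k)).
apply: contrapT => nex; apply: nW.
have bad (k : nat) : exists t : M * M * R,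
    [/\ (~` A `&` chart_dom (sval phi)) t.1.1,
        (A `&` chart_dom (sval phi)) t.1.2, 0 < t.2,
        `|sval phi t.1.1 - sval phi x| < harmonic k /\
        `|sval phi t.1.2 - sval phi x| < harmonic k &
        `|t.2 *: (sval phi t.1.1 - sval phi t.1.2) - v| < harmonic k].
  apply: contrapT => nt; apply: nex; exists (harmonic k).
    exact: harmonic_gt0.
  move=> b a c db da bx ax c0 cv Ab; apply: contrapT => nAa.
  by apply: nt; exists (a, b, c); split.
have [f fP] := choice bad.
have cvgh (g : nat -> 'rV[R]_n) l :
    (forall k, `|g k - l| < harmonic k) -> g @ \oo --> l.
  move=> gl; apply/cvgrPdistC_lt => e e0.
  have : \forall k \near \oo, harmonic k < e.
    exact: (cvgr_lt 0 cvg_harmonic).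
  by apply: filterS => k; exact: lt_trans.
have cvgM (g : nat -> M) : (forall k, chart_dom (sval phi) (g k)) ->
    (forall k, `|sval phi (g k) - sval phi x| < harmonic k) -> g @ \oo --> x.
  move=> dg /(cvgh (sval phi \o g)) gx.
  rewrite (_ : g = chart_inv (sval phi) \o (sval phi \o g)).
    exact: cvg_comp gx (chart_inv_cvg phi).
  by apply/funext => k; rewrite /= chart_funK.
exists (fun k => (f k).1.1), (fun k => (f k).1.2), (fun k => (f k).2).
split; [by move=> k; case: (fP k)..| |].
- by split; apply: cvgM => k; case: (fP k) => [[? ?] [? ?] ? [? ?] ?].
- by apply: cvgh => k; case: (fP k).
Qed.

(** The chart is existential in [whitney_cone], hence universal in its complement: later proofs may
    work in any chart at [x]. *)
Lemma gamma_setP (gamma : set (tangent_bundle M)) A :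
  gamma_set gamma A <->
  forall x (v : tangent x) (phi : chart_at x), gamma (TangentVector v) ->
    exists2 e, 0 < e & flows_into (sval phi) (sval phi x) (v phi) e A A.
Proof.
split=> [gA x v phi gv|fl [x v] gv [phi] /=].
  by apply/not_whitneyP => W; apply: (gA _ gv); exists phi.
exact/not_whitneyP/fl.
Qed.

(** * A radius independent of the gamma-set *)

Lemma norm_segment_lt (V : normedModType R) (p q r : V) (e t : R) :
  0 <= t <= 1 -> `|p - r| < e -> `|q - r| < e ->
  `|p + t *: (q - p) - r| < e.
Proof.
move=> /andP[t0 t1] pe qe.
have -> : p + t *: (q - p) - r = (1 - t) *: (p - r) + t *: (q - r).
  rewrite scalerBl scale1r -[RHS]addrA [X in _ = _ + X]addrC -scalerBr opprB subrKA.
  by rewrite addrAC.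
apply: le_lt_trans (ler_normD _ _) _.
rewrite !normrZ (ger0_norm t0) ger0_norm ?subr_ge0//.
(* Bounding by the larger norm [m] keeps the inequality strict at [t = 0] and [t = 1], where one
   term vanishes. *)
have [m [me pm qm]] : exists m, [/\ m < e, `|p - r| <= m & `|q - r| <= m].
  by exists (Num.max `|p - r| `|q - r|); rewrite gt_max pe qe !le_max !lexx orbT.
apply: le_lt_trans me.
have := ler_wpM2l t0 qm.
have : (1 - t) * `|p - r| <= (1 - t) * m by rewrite ler_wpM2l// subr_ge0.
lra.
Qed.

(** The radius comes from [gamma] alone: in the chart, points and directions [e]-close to those of
    [v] stay in [gamma]. The smaller radii that depend on [A] along the segment are absorbed by
    [segment_propagation]. *)
Lemma gamma_set_uniform (gamma : set (tangent_bundle M)) x (v : tangent x)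
    (phi : chart_at x) :
  open gamma -> gamma (TangentVector v) ->
  exists2 e, 0 < e & forall A, gamma_set gamma A ->
    flows_into (sval phi) (sval phi x) (v phi) e A A.
Proof.
move=> ogamma gv; have [aphi dx] := svalP phi.
have oim : open (bundle_chart_image (sval phi) gamma) by exact: ogamma.
have : nbhs (sval phi x, v phi) (bundle_chart_image (sval phi) gamma).
  by apply: open_nbhs_nbhs; split=> //; exists (TangentVector v), phi.
move=> /nbhs_ballP[e /= e0 eim].
exists e => // A gA b a c db da bx ax c0 cv Ab.
(* The direction [w] stays fixed while the base point runs along the segment [p]. *)
set w := c *: (_ - _) in cv.
pose p (t : R) := sval phi b + t *: (sval phi a - sval phi b).
have inim t : 0 <= t <= 1 -> bundle_chart_image (sval phi) gamma (p t, w).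
  move=> t01; apply: eim; split; rewrite /= -ball_normE /ball_/= distrC//.
  exact: norm_segment_lt.
have dp t : 0 <= t <= 1 ->
    chart_dom (sval phi) (chart_inv (sval phi) (p t)) /\
    sval phi (chart_inv (sval phi) (p t)) = p t.
  move=> /inim[[y u] /= [psi [_ psiE [-> _]]]].
  have [_] := svalP psi; rewrite psiE => dy.
  by rewrite chart_funK.
have p0 : p 0 = sval phi b by rewrite /p scale0r addr0.
have p1 : p 1 = sval phi a by rewrite /p scale1r addrC subrK.
rewrite -(chart_funK da) -p1.
apply: (@segment_propagation _ (fun t => A (chart_inv (sval phi) (p t)))).
  2: by rewrite p0 chart_funK.
move=> t /[dup] t01 /inim[[y u] /= [psi [gu psiE [pt wE]]]].
have /gamma_setP/(_ y u psi gu)[d d0] := gA.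
rewrite psiE => fl.
have cp : p s @[s --> t] --> p t.
  by apply: cvgD; [exact: cvg_cst | apply: cvgZr_tmp; exact: cvg_id].
have : \forall s \near t, `|p s - p t| < d by exact: cvgr_distC_lt cp _ d0.
move=> /nbhs_ballP[d' /= d'0 nd].
exists d' => // s s' s0 ss' s'1 st s't.
have [ds es] : chart_dom (sval phi) (chart_inv (sval phi) (p s)) /\
    sval phi (chart_inv (sval phi) (p s)) = p s.
  by apply: dp; apply/andP; split; lra.
have [ds' es'] : chart_dom (sval phi) (chart_inv (sval phi) (p s')) /\
    sval phi (chart_inv (sval phi) (p s')) = p s'.
  by apply: dp; apply/andP; split; lra.
(* Since [p s' - p s] is [s' - s] times the whole chord, this factor gives the direction [w] with
   error 0. *)
apply: (fl _ _ (c / (s' - s))) => //.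
- by rewrite es -pt; apply: nd; rewrite -ball_normE /ball_/= distrC.
- by rewrite es' -pt; apply: nd; rewrite -ball_normE /ball_/= distrC.
- by rewrite divr_gt0// subr_gt0.
- have s's : s' - s != 0 by rewrite subr_eq0 gt_eqF.
  rewrite es es' -wE /p opprD addrACA subrr add0r -scalerBl scalerA divfK//.
  by rewrite subrr normr0.
Qed.

(** For fixed [c], the closeness conditions are open in the pair [(b, a)], so both points can be
    perturbed independently. *)
Lemma flows_into_closure_interior (phi : chart R n M) (p v : 'rV[R]_n) (e : R) A :
  flows_into phi p v e A A -> flows_into phi p v e (closure A) (interior A).
Proof.
move=> fl b a c db da bp ap c0 cv clb.
have nd y : chart_dom phi y -> \forall z \near y, chart_dom phi z.
  by move=> dy; apply: open_nbhs_nbhs; split=> //; exact: chart_dom_open.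
have np y : chart_dom phi y -> `|phi y - p| < e ->
    \forall z \near y, `|phi z - p| < e.
  move=> dy ype.
  have yp : `|phi z - p| @[z --> y] --> `|phi y - p|.
    by apply: cvg_norm; apply: cvgB; [exact: chart_fun_cont | exact: cvg_cst].
  exact: cvgr_lt yp _ ype.
have : \forall z \near (b, a), `|c *: (phi z.2 - phi z.1) - v| < e.
  have cvz : `|c *: (phi z.2 - phi z.1) - v| @[z --> (b, a)] -->
      `|c *: (phi a - phi b) - v|.
    apply: cvg_norm; apply: cvgB; last exact: cvg_cst.
    apply: cvgZl_tmp; apply: cvgB.
      by apply: (@cvg_comp _ _ _ snd phi); [exact: cvg_snd | exact: chart_fun_cont].
    by apply: (@cvg_comp _ _ _ fst phi); [exact: cvg_fst | exact: chart_fun_cont].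
  exact: cvgr_lt cvz _ cv.
move=> [[U V] /= [Ub Va] UV].
(* A single [b'] in [A] serves all [a'] close to [a], which puts a neighborhood of [a] in [A]. *)
have [b' [Ab' [[Ub' db'] bp']]] :=
  clb _ (filterI (filterI Ub (nd _ db)) (np _ db bp)).
change (nbhs a A).
apply: filterS (filterI (filterI Va (nd _ da)) (np _ da ap)) => a' [[Va' da'] ap'].
by apply: (fl b' a' c) => //; exact: (UV (b', a')).
Qed.

(** Used with a direction of [gamma] and with its opposite, to find points after and before [x] in
    any neighborhood. *)
Lemma chart_line x (phi : chart_at x) (v : 'rV[R]_n) (e : R) (U : set M) :
  0 < e -> nbhs x U ->
  \forall t \near (0 : R)^'+, exists y, [/\ U y, chart_dom (sval phi) y,
    `|sval phi y - sval phi x| < e & sval phi y = sval phi x + t *: v].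
Proof.
move=> e0 Ux; apply: cvg_within; have [_ dx] := svalP phi.
have cl : sval phi x + t *: v @[t --> (0 : R)] --> sval phi x.
  rewrite -[X in _ --> X]addr0 -[X in _ + X](scale0r v).
  by apply: cvgD; [exact: cvg_cst | apply: cvgZr_tmp; exact: cvg_id].
have nim : nbhs (sval phi x) (sval phi @` chart_dom (sval phi)).
  by apply: open_nbhs_nbhs; split; [exact: chart_im_open | exists x].
have ne : \forall t \near (0 : R), `|sval phi x + t *: v - sval phi x| < e.
  exact: cvgr_distC_lt cl _ e0.
have nU : \forall t \near (0 : R), U (chart_inv (sval phi) (sval phi x + t *: v)).
  exact: (cvg_comp _ _ cl (chart_inv_cvg phi) U Ux).
have nd : \forall t \near (0 : R),
    (sval phi @` chart_dom (sval phi)) (sval phi x + t *: v).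
  exact: (cl _ nim).
apply: filterS (filterI (filterI nU nd) ne) => t [[Ut [y dy yE]] ye].
exists (chart_inv (sval phi) (sval phi x + t *: v)).
rewrite -yE in Ut ye *; rewrite chart_funK// in Ut *.
Qed.

(** * Stability properties of gamma-sets *)

Section GammaSets.
Context (gamma : set (tangent_bundle M)) (hgamma : causal gamma).

Lemma gamma_set_closure_interior x (v : tangent x) (phi : chart_at x) A :
  gamma_set gamma A -> gamma (TangentVector v) ->
  exists2 e, 0 < e &
    flows_into (sval phi) (sval phi x) (v phi) e (closure A) (interior A).
Proof.
move=> /gamma_setP gA /(gA _ _ phi)[e e0 fl].
by exists e => //; exact: flows_into_closure_interior.
Qed.

(** [flows_into] is contravariant in its source set and covariant in its target, so the flow from
    [closure A] to [interior A] restricts to [B]. *)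
Lemma gamma_set_between A B : gamma_set gamma A ->
  interior A `<=` B -> B `<=` closure A -> gamma_set gamma B.
Proof.
move=> gA AB BA; apply/gamma_setP => x v phi gv.
have [e e0 fl] := gamma_set_closure_interior phi gA gv.
by exists e => // b a c db da bx ax c0 cv /BA clb; apply: AB; exact: (fl b a c).
Qed.

(** One radius must serve all members of [F] at once; this is where the openness of [gamma]
    enters. *)
Lemma gamma_set_bigcup (F : set (set M)) :
  (forall A, F A -> gamma_set gamma A) -> gamma_set gamma (\bigcup_(A in F) A).
Proof.
move=> gF; apply/gamma_setP => x v phi gv.
have [e e0 fl] := gamma_set_uniform phi (causal_open hgamma) gv.
exists e => // b a c db da bx ax c0 cv [A FA Ab]; exists A => //.
exact: (fl A (gF A FA) b a c).
Qed.

Lemma gamma_set_bigcap (F : set (set M)) :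
  (forall A, F A -> gamma_set gamma A) -> gamma_set gamma (\bigcap_(A in F) A).
Proof.
move=> gF; apply/gamma_setP => x v phi gv.
have [e e0 fl] := gamma_set_uniform phi (causal_open hgamma) gv.
exists e => // b a c db da bx ax c0 cv Ab A FA.
exact: (fl A (gF A FA) b a c _ _ _ _ _ _ (Ab A FA)).
Qed.

Lemma closure_interior_gamma_set A : gamma_set gamma A ->
  closure (interior A) = closure A.
Proof.
move=> gA; apply/seteqP; split; first by apply: closureS; exact: interior_subset.
move=> x clx U Ux.
have [v gv] := causal_fibre_nonempty hgamma x.
have [phi aphi dx] := atlas_cover x.
pose psi : chart_at x := exist _ phi (conj aphi dx).
have [e e0 fl] := gamma_set_closure_interior psi gA gv.
have := chart_line psi (v psi) e0 Ux.
move=> /(filterI (nbhs_right_gt (0 : R)))/filter_ex[t [t0]].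
move=> [y [Uy dy ye yE]].
(* The flow starts at [x], and the factor [t^-1] recovers [v psi] exactly. *)
exists y; split=> //; apply: (fl x y t^-1) => //.
- by rewrite subrr normr0.
- by rewrite invr_gt0.
- by rewrite yE (addrC (phi x)) addrK scalerA mulVf ?gt_eqF// scale1r subrr normr0.
Qed.

Lemma interior_closure_gamma_set A : gamma_set gamma A ->
  interior (closure A) = interior A.
Proof.
move=> gA; apply/seteqP; split; last by apply: interiorS; exact: subset_closure.
move=> x intx.
have [v gv] := causal_fibre_nonempty hgamma x.
have [phi aphi dx] := atlas_cover x.
pose psi : chart_at x := exist _ phi (conj aphi dx).
have [e e0 fl] := gamma_set_closure_interior psi gA gv.
(* Going backwards gives a point [y] of [closure A] from which [x] is reached in the direction
   [v psi]. *)
have := chart_line psi (- v psi) e0 intx.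
move=> /(filterI (nbhs_right_gt (0 : R)))/filter_ex[t [t0]].
move=> [y [Ay dy ye yE]].
apply: (fl y x t^-1) => //.
- by rewrite subrr normr0.
- by rewrite invr_gt0.
- rewrite yE opprD addrA subrr add0r -scalerN opprK.
  by rewrite scalerA mulVf ?gt_eqF// scale1r subrr normr0.
Qed.

End GammaSets.
End LocalForm.

Theorem proposition1p21 (R : realType) (n : nat) (M : manifold R n)
    (gamma : set (tangent_bundle M)) (hgamma : causal gamma) :
  (forall F : set (set M), (forall A, F A -> gamma_set gamma A) ->
     gamma_set gamma (\bigcup_(A in F) A) /\
     gamma_set gamma (\bigcap_(A in F) A)) /\
  (forall A : set M, gamma_set gamma A ->
     gamma_set gamma (closure A) /\ gamma_set gamma (interior A)) /\
  (forall A : set M, gamma_set gamma A ->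
     closure (interior A) = closure A /\
     interior (closure A) = interior A) /\
  (forall A B : set M, gamma_set gamma A ->
     interior A `<=` B -> B `<=` closure A -> gamma_set gamma B).
Proof.
have incl (A : set M) : interior A `<=` closure A.
  exact: subset_trans (@interior_subset _ A) (@subset_closure _ A).
split=> [F gF|]; last split=> [A gA|]; last split=> [A gA|A B].
- by split; [exact: gamma_set_bigcup | exact: gamma_set_bigcap].
(* Both sets lie between [interior A] and [closure A]. *)
- by split; apply: (gamma_set_between gA).
- by rewrite (closure_interior_gamma_set hgamma)//
    (interior_closure_gamma_set hgamma).
- exact: gamma_set_between.
Qed.
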